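(* Let $(\mathfrak{g},[\cdot,\cdot],\alpha)$ be a regular hom-Lie algebra. An element $r\in\mathcal{H}^2$ is a (skew-symmetric) $r$-matrix on $(\mathfrak{g},[\cdot,\cdot],\alpha)$ if and only if the associated operator $r^\sharp:\mathfrak{g}^*\to\mathfrak{g}$, defined by $\langle\xi,r^\sharp(\eta)\rangle=\langle\xi\otimes\eta,r\rangle$ for all $\xi,\eta\in\mathfrak{g}^*$, is an $\mathcal{O}$-operator on $(\mathfrak{g},[\cdot,\cdot],\alpha)$ with respect to the coadjoint representation $(\mathfrak{g}^*,(\alpha^{-1})^*,\mathrm{ad}^\star)$.
   Context: The base field $k$ has characteristic zero. A (multiplicative) hom-Lie algebra $(\mathfrak{g},[\cdot,\cdot],\alpha)$ is a vector space $\mathfrak{g}$ with a skew-symmetric bilinear bracket and a linear map $\alpha:\mathfrak{g}\to\mathfrak{g}$ with $\alpha[x,y]=[\alpha(x),\alpha(y)]$ and $[\alpha(x),[y,z]]+[\alpha(y),[z,x]]+[\alpha(z),[x,y]]=0$; it is regular if $\alpha$ is invertible. A representation $(V,\beta,\rho)$ is a vector space $V$, $\beta\in\mathrm{End}(V)$ and a linear map $\rho:\mathfrak{g}\to\mathrm{End}(V)$ with $\rho(\alpha(x))(\beta(v))=\beta(\rho(x)(v))$ and $\rho([x,y])(\beta(v))=\rho(\alpha(x))\rho(y)(v)-\rho(\alpha(y))\rho(x)(v)$. An $\mathcal{O}$-operator on $(\mathfrak{g},[\cdot,\cdot],\alpha)$ with respect to $(V,\beta,\rho)$ is a linear map $T:V\to\mathfrak{g}$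 with $T\circ\beta=\alpha\circ T$ and $[Tu,Tv]=T(\rho(Tu)(v)-\rho(Tv)(u))$ for all $u,v\in V$. The coadjoint representation of a regular hom-Lie algebra is $(\mathfrak{g}^*,(\alpha^{-1})^*,\mathrm{ad}^\star)$ with $\langle\mathrm{ad}^\star(x)(\xi),y\rangle=-\langle\xi,[\alpha^{-1}(x),\alpha^{-2}(y)]\rangle$ for $x,y\in\mathfrak{g}$, $\xi\in\mathfrak{g}^*$. On $\wedge^*\mathfrak{g}$ define $$[x_1\wedge\cdots\wedge x_n,y_1\wedge\cdots\wedge y_m]_g=\sum_{i=1}^n\sum_{j=1}^m(-1)^{i+j}[x_i,y_j]\wedge\alpha(x_1)\wedge\cdots\widehat{\alpha(x_i)}\cdots\wedge\alpha(x_n)\wedge\alpha(y_1)\wedge\cdots\widehat{\alpha(y_j)}\cdots\wedge\alpha(y_m)$$ and $\tilde\alpha(x_1\wedge\cdots\wedge x_n)=\alpha(x_1)\wedge\cdots\wedge\alpha(x_n)$. Let $\mathcal{H}^n=\{\chi\in\wedge^n\mathfrak{g}\mid\tilde\alpha(\chi)=\chi\}$. A skew-symmetric $r$-matrix on $(\mathfrak{g},[\cdot,\cdot],\alpha)$ is an element $r\in\mathcal{H}^2$ with $[r,r]_g=0$. Elements of $\wedge^2\mathfrak{g}$ are regarded as skew-symmetric elements of $\mathfrak{g}\otimes\mathfrak{g}$ via $x\wedge y\mapsto x\otimes y-y\otimes x$. *)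

(* Defs.v *)
From HB Require Import structures.
From mathcomp Require Import all_boot all_order all_algebra all_fingroup.
From mathcomp Require Import generic_quotient ring_quotient.
From mathcomp.classical Require Import boolp.
From mathcomp.multinomials Require Import freeg.

Set Implicit Arguments.
Unset Strict Implicit.
Unset Printing Implicit Defensive.

Import GRing.Theory.

(* [freeg] also exports a [lift]. *)
Local Notation lift := fintype.lift.
Local Open Scope ring_scope.
Local Open Scope quotient_scope.

(** ** Vector spaces presented by generators and relations *)

Section Presentation.
Variables (k : fieldType) (K : choiceType).
Local Notation free := {freeg K / k}.

Lemma fglift_linear (W : lmodType k) (f : K -> W) : linear (fglift f).
Proof.
have fD : {morph fglift f : x y / x + y}.
  have fB := @lift_is_additive k K W f.
  have f0 : fglift f 0 = 0 by rewrite -(subrr 0) fB subrr.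
  have fN x : fglift f (- x) = - fglift f x by rewrite -sub0r fB f0 sub0r.
  by move=> x y; rewrite -[in LHS](opprK y) fB fN opprK.
have f0 : fglift f 0 = 0 by apply: (addrI (fglift f 0)); rewrite -fD !addr0.
have fsum (I : Type) (s : seq I) (F : I -> free) :
    fglift f (\sum_(i <- s) F i) = \sum_(i <- s) fglift f (F i).
  by elim: s => [|i s IH]; rewrite ?big_nil // !big_cons fD IH.
move=> a u v; rewrite fD; congr (_ + _).
have -> : a *: u = fgscale a u by [].
rewrite -[in RHS](freeg_sumE u) /fgscale !fsum scaler_sumr.
by apply: eq_bigr => x _; rewrite !liftU scalerA.
Qed.

Variable rel : free -> Prop.

Definition in_span (u : free) : Prop :=
  forall P : free -> Prop,
    P 0 -> (forall a x y, P x -> P y -> P (a *: x + y)) ->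
    (forall x, rel x -> P x) -> P u.

Definition spanp : {pred free} := fun u => `[< in_span u >].

Lemma spanpP u : reflect (in_span u) (u \in spanp).
Proof. exact: asboolP. Qed.

Lemma spanp_comb a x y : x \in spanp -> y \in spanp -> a *: x + y \in spanp.
Proof.
move=> /spanpP hx /spanpP hy; apply/spanpP=> P P0 PZ PR.
move: (hx P P0 PZ PR) (hy P P0 PZ PR).
exact: PZ.
Qed.

Lemma spanp0 : 0 \in spanp. Proof. by apply/spanpP=> P. Qed.

Fact spanp_zmod_closed : zmod_closed spanp.
Proof.
split=> [|x y hx hy]; first exact: spanp0.
by rewrite addrC -scaleN1r; apply: spanp_comb.
Qed.

HB.instance Definition _ := GRing.isZmodClosed.Build _ spanp spanp_zmod_closed.

Definition presented := Quotient.quot (spanp : zmodClosed free).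

HB.instance Definition _ := Choice.on presented.
HB.instance Definition _ := GRing.Zmodule.on presented.

Definition proj (u : free) : presented := \pi_presented u.

Lemma projK X : proj (repr X) = X.
Proof. exact: reprK. Qed.

Lemma projD u v : proj (u + v) = proj u + proj v.
Proof. by rewrite /proj -[RHS]Quotient.pi_add. Qed.

Lemma eq_proj u v : (proj u == proj v) = (u - v \in spanp).
Proof. by rewrite (Quotient.idealrBE (spanp : zmodClosed free)). Qed.

Definition pscale (a : k) (X : presented) : presented := proj (a *: repr X).

Lemma projZ a u : proj (a *: u) = pscale a (proj u).
Proof.
apply/eqP; rewrite eq_proj -scalerBr -[_ *: _]addr0 spanp_comb ?spanp0 //.
by rewrite -eq_proj projK.
Qed.

Fact pscaleA a b X : pscale a (pscale b X) = pscale (a * b) X.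
Proof. by rewrite -[X]projK -!projZ scalerA. Qed.
Fact pscale1 X : pscale 1 X = X.
Proof. by rewrite -[X]projK -!projZ scale1r. Qed.
Fact pscaleDr a X Y : pscale a (X + Y) = pscale a X + pscale a Y.
Proof. by rewrite -[X]projK -[Y]projK -projD -!projZ scalerDr projD. Qed.
Fact pscaleDl X a b : pscale (a + b) X = pscale a X + pscale b X.
Proof. by rewrite -[X]projK -!projZ scalerDl projD. Qed.

HB.instance Definition _ := GRing.Zmodule_isLmodule.Build k presented
  pscaleA pscale1 pscaleDr pscaleDl.

Fact proj_linear : linear proj.
Proof. by move=> a u v; rewrite projD projZ. Qed.

Definition gen (x : K) : presented := proj << x >>.

Lemma presented_ind (P : presented -> Prop) :
  P 0 -> (forall a x X, P X -> P (a *: gen x + X)) -> forall X, P X.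
Proof.
move=> P0 PZ X; rewrite -[X]projK -[repr X]freeg_sumE.
have p0 : proj 0 = 0 by apply: (addrI (proj 0)); rewrite -projD !addr0.
elim: (dom _) => [|x s IH]; first by rewrite big_nil p0.
rewrite big_cons projD.
suff -> : << coeff x (repr X) *g x >> = coeff x (repr X) *: << x >> :> free.
  by rewrite projZ; apply: PZ.
apply/eqP/freeg_eqP => y; by rewrite coeffZ !coeffU mul1r.
Qed.

(* Linear extension of a map on generators; it is meaningful when the map
   respects the relations, see [extend_gen] and [extend_linear]. *)
Definition extend (W : lmodType k) (f : K -> W) (X : presented) : W :=
  fglift f (repr X).

Section Extend.
Variables (W : lmodType k) (f : K -> W).
Hypothesis f_rel : forall u, rel u -> fglift f u = 0.

Lemma extend_proj u : extend f (proj u) = fglift f u.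
Proof.
rewrite /extend; set v := repr _.
have /spanpP h : v - u \in spanp by rewrite -eq_proj projK.
have fl := fglift_linear f.
have f0 : fglift f 0 = 0.
  by have := fl (-1) 0 0; rewrite scaler0 addr0 scaleN1r addNr.
have : fglift f (v - u) = 0.
  apply: (h (fun w => fglift f w = 0)) => // a x y hx hy.
  by rewrite fl hx hy scaler0 addr0.
by rewrite addrC -scaleN1r fl scaleN1r addrC => /eqP; rewrite subr_eq0 => /eqP.
Qed.

Lemma extend_gen x : extend f (gen x) = f x.
Proof. by rewrite extend_proj liftU scale1r. Qed.

Lemma extend_linear : linear (extend f).
Proof.
move=> a X Y; rewrite -[X]projK -[Y]projK -proj_linear !extend_proj.
exact: fglift_linear.
Qed.
End Extend.

End Presentation.

(** ** Tensor and exterior powers of a vector space *)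

Section Multilinear.
Variables (k : fieldType) (V : lmodType k) (n : nat).

(* [x] with its [i]-th entry replaced by [v]. *)
Definition upd (x : 'rV[V]_n) (i : 'I_n) (v : V) : 'rV[V]_n :=
  \row_j if j == i then v else x 0 j.

Definition multilinear (W : lmodType k) (f : 'rV[V]_n -> W) : Prop :=
  forall x i, linear (fun v => f (upd x i v)).

Definition alternating (W : lmodType k) (f : 'rV[V]_n -> W) : Prop :=
  forall (x : 'rV[V]_n) i j, i != j -> x 0 i = x 0 j -> f x = 0.

Inductive multilinear_rel : {freeg 'rV[V]_n / k} -> Prop :=
  MultilinearRel x i a u v :
    multilinear_rel
      (<< upd x i (a *: u + v) >> - (a *: << upd x i u >> + << upd x i v >>)).

Inductive alternating_rel : {freeg 'rV[V]_n / k} -> Prop :=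
  AlternatingRel (x : 'rV[V]_n) i j of i != j & x 0 i = x 0 j :
    alternating_rel << x >>.

Definition tensor_power := presented multilinear_rel.
HB.instance Definition _ := GRing.Lmodule.on tensor_power.

Definition exterior_power :=
  presented (fun u => multilinear_rel u \/ alternating_rel u).
HB.instance Definition _ := GRing.Lmodule.on exterior_power.

Definition tensor (x : 'rV[V]_n) : tensor_power := gen _ x.
Definition wedge (x : 'rV[V]_n) : exterior_power := gen _ x.

Definition tensor_lift (W : lmodType k) (f : 'rV[V]_n -> W) :
  tensor_power -> W := extend f.
Definition wedge_lift (W : lmodType k) (f : 'rV[V]_n -> W) :
  exterior_power -> W := extend f.

Section UniversalProperty.
Variables (W : lmodType k) (f : 'rV[V]_n -> W).

Lemma multilinear_relP : multilinear f ->
  forall u, multilinear_rel u -> fglift f u = 0.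
Proof.
move=> fl _ [x i a u v]; have fgl := fglift_linear f.
rewrite addrC -scaleN1r !fgl !liftU !scale1r fl scaleN1r; exact: addNr.
Qed.

Lemma alternating_relP : alternating f ->
  forall u, alternating_rel u -> fglift f u = 0.
Proof. by move=> fa _ [x i j ij e]; rewrite liftU (fa x i j) // scaler0. Qed.

Hypothesis f_lin : multilinear f.

Lemma tensor_liftE x : tensor_lift f (tensor x) = f x.
Proof. exact: (extend_gen (multilinear_relP f_lin)). Qed.

Lemma tensor_lift_linear : linear (tensor_lift f).
Proof. exact: (extend_linear (multilinear_relP f_lin)). Qed.

Hypothesis f_alt : alternating f.

Lemma wedge_relP u : multilinear_rel u \/ alternating_rel u -> fglift f u = 0.
Proof.
by case; [exact: multilinear_relP | exact: alternating_relP].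
Qed.

Lemma wedge_liftE x : wedge_lift f (wedge x) = f x.
Proof. exact: (extend_gen wedge_relP). Qed.

Lemma wedge_lift_linear : linear (wedge_lift f).
Proof. exact: (extend_linear wedge_relP). Qed.

End UniversalProperty.

Lemma wedge_multilinear : multilinear wedge.
Proof.
move=> x i a u v; rewrite /wedge /gen -(proj_linear _ a).
apply/eqP; rewrite eq_proj; apply/spanpP=> P _ _; apply.
by left; constructor.
Qed.

Lemma wedge_alternating : alternating wedge.
Proof.
move=> x i j ij e; rewrite /wedge /gen.
set R := (X in proj X _).
have p0 : proj R 0 = 0 by apply: (addrI (proj R 0)); rewrite -projD !addr0.
rewrite -[RHS]p0.
apply/eqP; rewrite eq_proj subr0; apply/spanpP=> P _ _; apply.
by right; apply: (AlternatingRel ij e).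
Qed.

Lemma wedge_ind (P : exterior_power -> Prop) :
  P 0 -> (forall a x X, P X -> P (a *: wedge x + X)) -> forall X, P X.
Proof. exact: presented_ind. Qed.

Lemma tensor_multilinear : multilinear tensor.
Proof.
move=> x i a u v; rewrite /tensor /gen -(proj_linear _ a).
by apply/eqP; rewrite eq_proj; apply/spanpP=> P _ _; apply; constructor.
Qed.

End Multilinear.

Section MultilinearTheory.
Variables (k : fieldType) (V W : lmodType k).

Lemma updE n (x : 'rV[V]_n) i v : upd x i v 0 i = v.
Proof. by rewrite mxE eqxx. Qed.

Lemma upd_neq n (x : 'rV[V]_n) i j v : j != i -> upd x i v 0 j = x 0 j.
Proof. by rewrite mxE => /negPf->. Qed.

Lemma upd_id n (x : 'rV[V]_n) i : upd x i (x 0 i) = x.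
Proof. by apply/rowP=> j; rewrite mxE; case: eqP => // ->. Qed.

Lemma updC n (x : 'rV[V]_n) i j u v :
  i != j -> upd (upd x i u) j v = upd (upd x j v) i u.
Proof.
move=> ij; apply/rowP=> l; rewrite !mxE.
by case: (eqVneq l j) => // ->; rewrite eq_sym (negPf ij).
Qed.

Lemma col'_upd n (x : 'rV[V]_n.+1) i v : col' i (upd x i v) = col' i x.
Proof. by apply/rowP=> j; rewrite !mxE eq_sym (negPf (neq_lift i j)). Qed.

Lemma col'_upd_lift n (x : 'rV[V]_n.+1) i j v :
  col' i (upd x (lift i j) v) = upd (col' i x) j v.
Proof. by apply/rowP=> l; rewrite !mxE (inj_eq lift_inj). Qed.

Lemma row_mx_updl n m (x : 'rV[V]_n) (y : 'rV[V]_m) i v :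
  row_mx (upd x i v) y = upd (row_mx x y) (lshift m i) v.
Proof.
apply/rowP=> j; rewrite !mxE; case: (split_ordP j) => l ->.
  by rewrite (inj_eq (@lshift_inj _ _)) mxE.
by rewrite eq_rlshift.
Qed.

Lemma row_mx_updr n m (x : 'rV[V]_n) (y : 'rV[V]_m) i v :
  row_mx x (upd y i v) = upd (row_mx x y) (rshift n i) v.
Proof.
apply/rowP=> j; rewrite !mxE; case: (split_ordP j) => l ->.
  by rewrite eq_lrshift.
by rewrite (inj_eq (@rshift_inj _ _)) mxE.
Qed.

Lemma multilinear_row_mxl n m (f : 'rV[V]_(n + m) -> W) y :
  multilinear f -> multilinear (fun x : 'rV[V]_n => f (row_mx x y)).
Proof. by move=> fl x i a u v; rewrite !row_mx_updl fl. Qed.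

Lemma multilinear_row_mxr n m (f : 'rV[V]_(n + m) -> W) x :
  multilinear f -> multilinear (fun y : 'rV[V]_m => f (row_mx x y)).
Proof. by move=> fl y i a u v; rewrite !row_mx_updr fl. Qed.

Lemma alternating_row_mxl n m (f : 'rV[V]_(n + m) -> W) y :
  alternating f -> alternating (fun x : 'rV[V]_n => f (row_mx x y)).
Proof.
move=> fa x i j ij e; apply: (fa _ (lshift m i) (lshift m j)).
  by rewrite (inj_eq (@lshift_inj _ _)).
by rewrite !row_mxEl.
Qed.

Lemma alternating_row_mxr n m (f : 'rV[V]_(n + m) -> W) x :
  alternating f -> alternating (fun y : 'rV[V]_m => f (row_mx x y)).
Proof.
move=> fa y i j ij e; apply: (fa _ (rshift n i) (rshift n j)).
  by rewrite (inj_eq (@rshift_inj _ _)).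
by rewrite !row_mxEr.
Qed.

Lemma linear_sum_fun (U : lmodType k) (I : finType) (c : I -> k)
    (F : I -> U -> W) :
  (forall i, linear (F i)) -> linear (fun u => \sum_i c i *: F i u).
Proof.
move=> Fl a u v; rewrite scaler_sumr -big_split; apply: eq_bigr => i _ /=.
by rewrite Fl scalerDr !scalerA mulrC.
Qed.

Lemma alternating_swap n (f : 'rV[V]_n -> W) (x : 'rV[V]_n) i j :
  multilinear f -> alternating f -> i != j ->
  f (col_perm (tperm i j) x) = - f x.
Proof.
move=> fl fa ij; pose g u v := f (upd (upd x i u) j v).
have gD u1 u2 v : g (u1 + u2) v = g u1 v + g u2 v.
  have gE u w : g u w = f (upd (upd x j w) i u) by rewrite /g updC.
  by rewrite !gE -[u1]scale1r fl !scale1r.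
have gD' u v1 v2 : g u (v1 + v2) = g u v1 + g u v2.
  by rewrite /g -[v1]scale1r fl !scale1r.
have g0 u : g u u = 0.
  by apply: (fa _ i j ij); rewrite updE upd_neq // updE.
have -> : col_perm (tperm i j) x = upd (upd x i (x 0 j)) j (x 0 i).
  apply/rowP=> l; rewrite !mxE; case: tpermP => [->|->|/eqP/negPf-> /eqP/negPf->] //.
    by rewrite (negPf ij) eqxx.
  by rewrite eqxx.
have -> : f x = g (x 0 i) (x 0 j).
  by rewrite /g upd_id upd_id.
apply/eqP; rewrite -addr_eq0; apply/eqP.
have := g0 (x 0 i + x 0 j); rewrite gD !gD' !g0 addr0 add0r => <-.
by rewrite addrC.
Qed.

Lemma alternating_perm n (f : 'rV[V]_n -> W) (s : 'S_n) (x : 'rV[V]_n) :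
  multilinear f -> alternating f -> f (col_perm s x) = (-1) ^+ s *: f x.
Proof.
move=> fl fa; have [ts -> ] := prod_tpermP s.
elim: ts x => [|t ts IH] x /=.
  by rewrite big_nil odd_perm1 col_perm1 scale1r.
case/andP=> dt dts; rewrite big_cons odd_permM col_permM alternating_swap //.
by rewrite IH // odd_tperm dt signr_addb expr1 -scalerA scaleN1r.
Qed.

Section Insertion.
Variables (n : nat) (al : {linear V -> V}) (G : V -> 'rV[V]_n -> W).
Hypothesis Gl : forall z, linear (G^~ z).
Hypothesis Gm : forall c, multilinear (G c).
Hypothesis Ga : forall c, alternating (G c).

Let S (x : 'rV[V]_n.+1) :=
  \sum_(i < n.+1) (-1) ^+ i *: G (x 0 i) (map_mx al (col' i x)).

Lemma map_mx_upd m (x : 'rV[V]_m) i v :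
  map_mx al (upd x i v) = upd (map_mx al x) i (al v).
Proof. by apply/rowP=> j; rewrite !mxE; case: ifP. Qed.

Lemma insertion_multilinear : multilinear S.
Proof.
move=> x p; apply: linear_sum_fun => i a u v.
case: (unliftP i p) => [q|] ->.
  by rewrite !col'_upd_lift !map_mx_upd !upd_neq ?neq_lift // linearP Gm.
by rewrite !updE !col'_upd Gl.
Qed.

Lemma insertion_alternating : alternating S.
Proof.
move=> x p q pq e; rewrite /S (bigD1 p) //= (bigD1 q) 1?eq_sym //=.
rewrite big1 ?addr0 => [|i /andP[ip iq]]; last first.
  case: (unliftP i p) ip => [p' Ep _|->]; last by rewrite eqxx.
  case: (unliftP i q) iq => [q' Eq _|->]; last by rewrite eqxx.
  rewrite (@Ga _ _ p' q') ?scaler0 //.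
    by apply: contraNneq pq => pq'; rewrite Ep Eq pq'.
  by rewrite !mxE -Ep -Eq e.
pose h (j : 'I_n) := odflt j (unlift q (tperm p q (lift p j))).
have hE j : lift q (h j) = tperm p q (lift p j).
  rewrite /h; case: unliftP => [l -> //|/(canRL (tpermK p q))].
  by rewrite tpermR => /eqP; rewrite eq_sym (negPf (neq_lift p j)).
have h_inj : injective h.
  by move=> j l /(congr1 (lift q)); rewrite !hE => /perm_inj/lift_inj.
have sE : tperm p q = lift_perm p q (perm h_inj).
  apply/permP=> j; case: (unliftP p j) => [l|] ->.
    by rewrite lift_perm_lift (permE h_inj) hE.
  by rewrite tpermL lift_perm_id.
have xE : map_mx al (col' p x) = col_perm (perm h_inj) (map_mx al (col' q x)).
  apply/rowP=> j; rewrite !mxE (permE h_inj) hE; congr (al _).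
  by case: tpermP => [->|->|].
rewrite xE alternating_perm // e scalerA -scalerDl.
suff -> : (-1) ^+ p * (-1) ^+ perm h_inj + (-1) ^+ q = 0 :> k by rewrite scale0r.
have : odd_perm (tperm p q) by rewrite odd_tperm.
rewrite sE odd_lift_perm -[(-1) ^+ p]signr_odd -[(-1) ^+ q]signr_odd.
case: (odd p) (odd q) (odd_perm _) => [] [] [] //= _;
  by rewrite ?expr0 ?expr1 ?mulr1 ?mul1r ?mulrNN ?mulr1 ?subrr ?addNr.
Qed.
End Insertion.

End MultilinearTheory.

(** ** Dual space and the pairing on tensors *)

Section Dual.
Variables (k : fieldType) (V : lmodType k).

Definition dual := {linear V -> k^o}.

Lemma dual_ext (xi eta : dual) : xi =1 eta -> xi = eta.
Proof.
case: xi eta => [f [[f1] [f2]]] [g [[g1] [g2]]] /= /funext fg.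
by subst g; rewrite (Prop_irrelevance f1 g1) (Prop_irrelevance f2 g2).
Qed.

HB.instance Definition _ := gen_eqMixin dual.
HB.instance Definition _ := gen_choiceMixin dual.

Definition dual_zero : dual := \0.
Definition dual_add (xi eta : dual) : dual := xi \+ eta.
Definition dual_opp (xi : dual) : dual := \- xi.
Definition dual_scale (a : k) (xi : dual) : dual := a \*: xi.

Fact dual_addA : associative dual_add.
Proof. by move=> xi eta zeta; apply: dual_ext => x /=; rewrite addrA. Qed.
Fact dual_addC : commutative dual_add.
Proof. by move=> xi eta; apply: dual_ext => x /=; rewrite addrC. Qed.
Fact dual_add0 : left_id dual_zero dual_add.
Proof. by move=> xi; apply: dual_ext => x /=; rewrite add0r. Qed.
Fact dual_addN : left_inverse dual_zero dual_opp dual_add.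
Proof. by move=> xi; apply: dual_ext => x /=; rewrite addNr. Qed.

HB.instance Definition _ :=
  GRing.isZmodule.Build dual dual_addA dual_addC dual_add0 dual_addN.

Fact dual_scaleA a b xi : dual_scale a (dual_scale b xi) = dual_scale (a * b) xi.
Proof. by apply: dual_ext => x /=; rewrite scalerA. Qed.
Fact dual_scale1 : left_id 1 dual_scale.
Proof. by move=> xi; apply: dual_ext => x /=; rewrite scale1r. Qed.
Fact dual_scaleDr : right_distributive dual_scale +%R.
Proof. by move=> a xi eta; apply: dual_ext => x /=; rewrite scalerDr. Qed.
Fact dual_scaleDl xi : {morph dual_scale^~ xi : a b / a + b}.
Proof. by move=> a b; apply: dual_ext => x /=; rewrite scalerDl. Qed.

HB.instance Definition _ := GRing.Zmodule_isLmodule.Build k dual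
  dual_scaleA dual_scale1 dual_scaleDr dual_scaleDl.

Definition row2 (u v : V) : 'rV[V]_2 := \row_i (if i == 0 then u else v).

Definition tensor2 (u v : V) : tensor_power V 2 := tensor (row2 u v).

(* The embedding u /\ v |-> u (x) v - v (x) u, see [wedge2_tensor_wedge]. *)
Definition wedge2_tensor : exterior_power V 2 -> tensor_power V 2 :=
  wedge_lift (fun x => tensor2 (x 0 0) (x 0 1) - tensor2 (x 0 1) (x 0 0)).

(* Evaluation of xi (x) eta on 2-tensors, see [pair2_tensor]. *)
Definition pair2 (xi eta : dual) : tensor_power V 2 -> k^o :=
  tensor_lift (fun x => xi (x 0 0) * eta (x 0 1) : k^o).

Lemma ord2P (i : 'I_2) : i = 0 \/ i = 1.
Proof. by case: i => [[|[|//]] h]; [left|right]; apply: val_inj. Qed.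

Lemma upd2_0 (x : 'rV[V]_2) v : upd x 0 v = row2 v (x 0 1).
Proof. by apply/rowP=> j; rewrite !mxE; case: (ord2P j) => ->. Qed.

Lemma upd2_1 (x : 'rV[V]_2) v : upd x 1 v = row2 (x 0 0) v.
Proof. by apply/rowP=> j; rewrite !mxE; case: (ord2P j) => ->. Qed.

Lemma row2_0 u v : row2 u v 0 0 = u. Proof. by rewrite mxE. Qed.
Lemma row2_1 u v : row2 u v 0 1 = v. Proof. by rewrite mxE. Qed.

Lemma row2K (x : 'rV[V]_2) : row2 (x 0 0) (x 0 1) = x.
Proof. by rewrite -upd2_0 upd_id. Qed.

Lemma multilinear2 (W : lmodType k) (f : V -> V -> W) :
  (forall v, linear (f^~ v)) -> (forall u, linear (f u)) ->
  multilinear (fun x : 'rV[V]_2 => f (x 0 0) (x 0 1)).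
Proof.
move=> fl fr x i a u v; case: (ord2P i) => ->.
  by rewrite !upd2_0 !(row2_0, row2_1) fl.
by rewrite !upd2_1 !(row2_0, row2_1) fr.
Qed.

Lemma alternating2 (W : lmodType k) (f : V -> V -> W) :
  (forall u, f u u = 0) ->
  alternating (fun x : 'rV[V]_2 => f (x 0 0) (x 0 1)).
Proof.
move=> f0 x i j; case: (ord2P i) => ->; case: (ord2P j) => -> //= _ e.
  by rewrite e f0.
by rewrite -e f0.
Qed.

Lemma tensor2_linearl v : linear (tensor2^~ v).
Proof.
move=> a u u'; have := @tensor_multilinear _ V 2 (row2 0 v) 0 a u u'.
by rewrite !upd2_0 !row2_1.
Qed.

Lemma tensor2_linearr u : linear (tensor2 u).
Proof.
move=> a v v'; have := @tensor_multilinear _ V 2 (row2 u 0) 1 a v v'.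
by rewrite !upd2_1 !row2_0.
Qed.

Let asym u v := tensor2 u v - tensor2 v u.

Let asym_linearl v : linear (asym^~ v).
Proof.
move=> a u u'; rewrite /asym tensor2_linearl tensor2_linearr.
by rewrite scalerBr opprD addrACA.
Qed.

Let asym_linearr u : linear (asym u).
Proof.
move=> a v v'; rewrite /asym tensor2_linearl tensor2_linearr.
by rewrite scalerBr opprD addrACA.
Qed.

Let asym_multilinear := multilinear2 asym_linearl asym_linearr.
Let asym_alternating := alternating2 (f := asym) (fun u => subrr _).

Lemma wedge2_tensor_wedge u v :
  wedge2_tensor (wedge (row2 u v)) = tensor2 u v - tensor2 v u.
Proof.
rewrite /wedge2_tensor (wedge_liftE asym_multilinear asym_alternating).
by rewrite row2_0 row2_1.
Qed.

Lemma wedge2_tensor_linear : linear wedge2_tensor.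
Proof. exact: (wedge_lift_linear asym_multilinear asym_alternating). Qed.

Section Pair2.
Variables xi eta : dual.

Let pair_multilinear :
  multilinear (fun x : 'rV[V]_2 => xi (x 0 0) * eta (x 0 1) : k^o).
Proof.
apply: (multilinear2 (f := fun u v => xi u * eta v : k^o)) => [v|u] a w w'.
  by rewrite linearP mulrDl -mulrA.
by rewrite linearP mulrDr mulrCA.
Qed.

Lemma pair2_tensor u v : pair2 xi eta (tensor2 u v) = xi u * eta v.
Proof. by rewrite /pair2 (tensor_liftE pair_multilinear) row2_0 row2_1. Qed.

Lemma pair2_linear : linear (pair2 xi eta).
Proof. exact: (tensor_lift_linear pair_multilinear). Qed.
End Pair2.

(* Every bivector has an associated operator from the (full algebraic) dual,
   also in infinite dimension. *)
Lemma sharp_exists (r : exterior_power V 2) : exists T : dual -> V,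
  forall xi eta : dual, xi (T eta) = pair2 xi eta (wedge2_tensor r).
Proof.
have z0 (U W : lmodType k) (f : U -> W) : linear f -> f 0 = 0.
  by move=> /(_ (-1) 0 0); rewrite scaler0 addr0 scaleN1r addNr.
elim/(@wedge_ind k V 2) : r => [|a x X [T hT]].
  exists (fun=> 0) => xi eta.
  by rewrite linear0 (z0 _ _ _ wedge2_tensor_linear) (z0 _ _ _ (pair2_linear _ _)).
exists (fun eta : dual => a *: (eta (x 0 1) *: x 0 0 - eta (x 0 0) *: x 0 1) + T eta).
move=> xi eta; rewrite wedge2_tensor_linear pair2_linear linearP hT.
congr (_ *: _ + _); rewrite -[x in wedge x]row2K wedge2_tensor_wedge.
rewrite -[- tensor2 _ _]scaleN1r [tensor2 _ _ + _]addrC pair2_linear.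
rewrite !pair2_tensor linearB !linearZ /= scaleN1r [RHS]addrC.
rewrite !scalerN; congr (_ - _); exact: mulrC.
Qed.

End Dual.

(** ** Hom-Lie algebras *)

Record hom_lie_algebra (k : fieldType) := HomLieAlgebra {
  hl_space :> lmodType k;
  bracket : hl_space -> hl_space -> hl_space;
  twist : {linear hl_space -> hl_space};
  bracket_linearl : forall y, linear (bracket^~ y);
  bracket_linearr : forall x, linear (bracket x);
  bracket_skew : forall x y, bracket x y = - bracket y x;
  twist_bracket : forall x y,
    twist (bracket x y) = bracket (twist x) (twist y);
  hom_jacobi : forall x y z,
    bracket (twist x) (bracket y z) + bracket (twist y) (bracket z x)
      + bracket (twist z) (bracket x y) = 0
}.

Arguments bracket {k h} : rename.
Arguments twist {k h} : rename.

Record regular_hom_lie_algebra (k : fieldType) := RegularHomLieAlgebra {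
  rhl_algebra :> hom_lie_algebra k;
  twist_inv : rhl_algebra -> rhl_algebra;
  twistK : cancel twist twist_inv;
  twist_invK : cancel twist_inv twist
}.

Arguments twist_inv {k r} : rename.

Record representation (k : fieldType) (g : hom_lie_algebra k) :=
Representation {
  rep_space :> lmodType k;
  rep_twist : {linear rep_space -> rep_space};
  rep_act : g -> {linear rep_space -> rep_space};
  rep_act_linear : forall v, linear (fun x => rep_act x v);
  rep_act_twist : forall x v,
    rep_act (twist x) (rep_twist v) = rep_twist (rep_act x v);
  rep_act_bracket : forall x y v,
    rep_act (bracket x y) (rep_twist v) =
      rep_act (twist x) (rep_act y v) - rep_act (twist y) (rep_act x v)
}.

Arguments rep_twist {k g r} : rename.
Arguments rep_act {k g r} : rename.

Definition O_operator (k : fieldType) (g : hom_lie_algebra k)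
    (V : representation g) (T : V -> g) : Prop :=
  [/\ linear T,
      forall v, T (rep_twist v) = twist (T v)
    & forall u v, bracket (T u) (T v) =
        T (rep_act (T u) v - rep_act (T v) u)].

Arguments O_operator {k g} V T.

Section Coadjoint.
Variables (k : fieldType) (g : regular_hom_lie_algebra k).
Implicit Types (x y : g) (xi : dual g).

Lemma twist_inv_linear : linear (@twist_inv k g).
Proof.
move=> a x y; apply: (can_inj (@twistK _ g)).
by rewrite linearP !twist_invK.
Qed.

Lemma twist_inv_bracket x y :
  twist_inv (bracket x y) = bracket (twist_inv x) (twist_inv y).
Proof.
by apply: (can_inj (@twistK _ g)); rewrite twist_bracket !twist_invK.
Qed.

Definition coadjoint_twist_fun xi (y : g) : k^o := xi (twist_inv y).

Fact coadjoint_twist_fun_linear xi : linear (coadjoint_twist_fun xi).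
Proof.
by move=> a y z; rewrite /coadjoint_twist_fun twist_inv_linear linearP.
Qed.

HB.instance Definition _ xi :=
  GRing.isLinear.Build k g k^o *:%R (coadjoint_twist_fun xi)
    (coadjoint_twist_fun_linear xi).

Definition coadjoint_twist xi : dual g := coadjoint_twist_fun xi.

Definition coadjoint_act_fun x xi (y : g) : k^o :=
  - xi (bracket (twist_inv x) (twist_inv (twist_inv y))).

Fact coadjoint_act_fun_linear x xi : linear (coadjoint_act_fun x xi).
Proof.
move=> a y z; rewrite /coadjoint_act_fun !twist_inv_linear bracket_linearr linearP opprD.
by rewrite scalerN.
Qed.

HB.instance Definition _ x xi :=
  GRing.isLinear.Build k g k^o *:%R (coadjoint_act_fun x xi)
    (coadjoint_act_fun_linear x xi).

Definition coadjoint_act x xi : dual g := coadjoint_act_fun x xi.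

Fact coadjoint_twist_linear : linear coadjoint_twist.
Proof. by move=> a xi eta; apply: dual_ext. Qed.

HB.instance Definition _ :=
  GRing.isLinear.Build k (dual g) (dual g) *:%R coadjoint_twist
    coadjoint_twist_linear.

Fact coadjoint_act_linear x : linear (coadjoint_act x).
Proof.
by move=> a xi eta; apply: dual_ext => y; rewrite /= /coadjoint_act_fun /= opprD scalerN.
Qed.

HB.instance Definition _ x :=
  GRing.isLinear.Build k (dual g) (dual g) *:%R (coadjoint_act x)
    (coadjoint_act_linear x).

Fact coadjoint_act_linearl xi : linear (coadjoint_act^~ xi).
Proof.
move=> a x y; apply: dual_ext => z; rewrite /= /coadjoint_act_fun.
by rewrite twist_inv_linear bracket_linearl linearP opprD scalerN.
Qed.

Fact coadjoint_act_twist x xi :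
  coadjoint_act (twist x) (coadjoint_twist xi)
    = coadjoint_twist (coadjoint_act x xi).
Proof.
apply: dual_ext => y; rewrite /= /coadjoint_act_fun /= /coadjoint_twist_fun /=.
by rewrite /coadjoint_act_fun twist_inv_bracket twistK.
Qed.

Fact coadjoint_act_bracket x y xi :
  coadjoint_act (bracket x y) (coadjoint_twist xi) =
    coadjoint_act (twist x) (coadjoint_act y xi)
      - coadjoint_act (twist y) (coadjoint_act x xi).
Proof.
apply: dual_ext => z; rewrite /= /coadjoint_act_fun /= /coadjoint_twist_fun.
rewrite /= /coadjoint_act_fun !twistK !twist_inv_bracket !opprK.
set x' := twist_inv (twist_inv x); set y' := twist_inv (twist_inv y).
set w := twist_inv (twist_inv (twist_inv (twist_inv z))).
have -> : twist_inv (twist_inv (twist_inv z)) = twist w by rewrite twist_invK.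
have -> : twist_inv x = twist x' by rewrite twist_invK.
have -> : twist_inv y = twist y' by rewrite twist_invK.
rewrite -linearB -linearN; congr (xi _).
have := hom_jacobi x' y' w.
rewrite [bracket w x']bracket_skew [bracket (twist w) _]bracket_skew.
have bN (x1 y1 : g) : bracket x1 (- y1) = - bracket x1 y1.
  have b0 : bracket x1 0 = 0 :> g.
    have := bracket_linearr x1 (-1) 0 0.
    by rewrite scaler0 addr0 scaleN1r addNr.
  have := bracket_linearr x1 (-1) y1 0.
  by rewrite b0 !addr0 !scaleN1r.
by rewrite bN => /eqP; rewrite subr_eq0 => /eqP <-; rewrite opprB.
Qed.

Definition coadjoint : representation g :=
  Representation coadjoint_act_linearl coadjoint_act_twist
    coadjoint_act_bracket.

End Coadjoint.

(** ** Multivectors *)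

Section Multivectors.
Variables (k : fieldType) (g : hom_lie_algebra k).

Definition twist_ext (n : nat) : exterior_power g n -> exterior_power g n :=
  wedge_lift (fun x => wedge (map_mx twist x)).

Definition twist_fixed (n : nat) (chi : exterior_power g n) : Prop :=
  twist_ext chi = chi.

(* Indices start at 0 here; [(-1) ^+ (i + j)] is the same sign as for indices
   starting at 1. *)
Definition bracket_wedge (n m : nat) (x : 'rV[g]_n.+1) (y : 'rV[g]_m.+1) :
    exterior_power g (1 + (n + m)) :=
  \sum_(i < n.+1) \sum_(j < m.+1) (-1) ^+ (i + j) *:
    wedge (row_mx (const_mx (bracket (x 0 i) (y 0 j)))
      (row_mx (map_mx twist (col' i x)) (map_mx twist (col' j y)))).

(* The bracket in positive degrees, characterized by [bracket_ext_wedge],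
   [bracket_ext_linearl] and [bracket_ext_linearr]; it vanishes when one of the
   arguments has degree 0. *)
Definition bracket_ext (n m : nat) (X : exterior_power g n.+1)
    (Y : exterior_power g m.+1) : exterior_power g (1 + (n + m)) :=
  wedge_lift (fun x => wedge_lift (bracket_wedge x) Y) X.

Definition r_matrix (r : exterior_power g 2) : Prop :=
  twist_fixed r /\ bracket_ext r r = 0.

Lemma twist_ext_multilinear n :
  multilinear (fun x : 'rV[g]_n => wedge (map_mx twist x)).
Proof. by move=> x i a u v; rewrite !map_mx_upd linearP wedge_multilinear. Qed.

Lemma twist_ext_alternating n :
  alternating (fun x : 'rV[g]_n => wedge (map_mx twist x)).
Proof.
by move=> x i j ij e; apply: (wedge_alternating ij); rewrite !mxE e.
Qed.

Lemma twist_ext_wedge n (x : 'rV[g]_n) :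
  twist_ext (wedge x) = wedge (map_mx twist x).
Proof.
exact: (wedge_liftE (@twist_ext_multilinear n) (@twist_ext_alternating n)).
Qed.

Lemma twist_ext_linear n : linear (@twist_ext n).
Proof.
exact: (wedge_lift_linear (@twist_ext_multilinear n) (@twist_ext_alternating n)).
Qed.

Section BracketWedge.
Variables n m : nat.

Lemma const_mx_linear_upd (u v : g) a l (z : 'rV[g]_l) :
  wedge (row_mx (const_mx (a *: u + v) : 'rV_1) z) =
    a *: wedge (row_mx (const_mx u : 'rV_1) z) + wedge (row_mx (const_mx v) z).
Proof.
have E w : const_mx w = upd (0 : 'rV[g]_1) 0 w.
  by apply/rowP=> j; rewrite ord1 !mxE eqxx.
by rewrite !E !row_mx_updl wedge_multilinear.
Qed.

Let insl (y : 'rV[g]_m.+1) (c : g) (z : 'rV[g]_n) :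
    exterior_power g (1 + (n + m)) :=
  \sum_(j < m.+1) (-1) ^+ j *: wedge (row_mx (const_mx (bracket c (y 0 j)))
    (row_mx z (map_mx twist (col' j y)))).

Let insr (x : 'rV[g]_n.+1) (c : g) (z : 'rV[g]_m) :
    exterior_power g (1 + (n + m)) :=
  \sum_(i < n.+1) (-1) ^+ i *: wedge (row_mx (const_mx (bracket (x 0 i) c))
    (row_mx (map_mx twist (col' i x)) z)).

Let bracket_wedgeEl x y : bracket_wedge x y =
  \sum_(i < n.+1) (-1) ^+ i *: insl y (x 0 i) (map_mx twist (col' i x)).
Proof.
apply: eq_bigr => i _; rewrite scaler_sumr; apply: eq_bigr => j _.
by rewrite exprD scalerA.
Qed.

Let bracket_wedgeEr x y : bracket_wedge x y =
  \sum_(j < m.+1) (-1) ^+ j *: insr x (y 0 j) (map_mx twist (col' j y)).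
Proof.
rewrite /bracket_wedge exchange_big; apply: eq_bigr => j _.
rewrite scaler_sumr; apply: eq_bigr => i _.
by rewrite exprD scalerA mulrC.
Qed.

Let alternating_sum (l : nat) (I : finType) (c : I -> k)
    (F : I -> 'rV[g]_l -> exterior_power g (1 + (n + m))) :
  (forall i, alternating (F i)) -> alternating (fun z => \sum_i c i *: F i z).
Proof.
move=> Fa x p q pq e; apply: big1 => i _.
by rewrite (Fa i x p q pq e) scaler0.
Qed.

Let insl_alternating y c : alternating (insl y c).
Proof.
apply: alternating_sum => j.
exact: (alternating_row_mxl _ (alternating_row_mxr (const_mx (bracket c (y 0 j)) : 'rV_1)
  (@wedge_alternating k g _))).
Qed.

Let insr_alternating x c : alternating (insr x c).
Proof.
apply: alternating_sum => j.
exact: (alternating_row_mxr _ (alternating_row_mxr (const_mx (bracket (x 0 j) c) : 'rV_1)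
  (@wedge_alternating k g _))).
Qed.

Let insl_multilinear y c : multilinear (insl y c).
Proof.
move=> x i; apply: linear_sum_fun => j; move: x i.
exact: (multilinear_row_mxl _ (multilinear_row_mxr (const_mx (bracket c (y 0 j)) : 'rV_1)
  (@wedge_multilinear k g _))).
Qed.

Let insr_multilinear x c : multilinear (insr x c).
Proof.
move=> y i; apply: linear_sum_fun => j; move: y i.
exact: (multilinear_row_mxr _ (multilinear_row_mxr (const_mx (bracket (x 0 j) c) : 'rV_1)
  (@wedge_multilinear k g _))).
Qed.

Let insl_linear y z : linear ((insl y)^~ z).
Proof.
apply: linear_sum_fun => j a u v.
by rewrite bracket_linearl const_mx_linear_upd.
Qed.

Let insr_linear x z : linear ((insr x)^~ z).
Proof.
apply: linear_sum_fun => j a u v.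
by rewrite bracket_linearr const_mx_linear_upd.
Qed.

Let multilinear_eq l (W : lmodType k) (f h : 'rV[g]_l -> W) :
  f =1 h -> multilinear h -> multilinear f.
Proof. by move=> fh hl x i a u v; rewrite !fh hl. Qed.

Let alternating_eq l (W : lmodType k) (f h : 'rV[g]_l -> W) :
  f =1 h -> alternating h -> alternating f.
Proof. by move=> fh hl x i j ij e; rewrite fh (hl x i j). Qed.

Lemma bracket_wedge_multilinearl y :
  multilinear (bracket_wedge (n := n) (m := m) ^~ y).
Proof.
apply: multilinear_eq (bracket_wedgeEl ^~ y) _.
exact: insertion_multilinear (insl_linear y) (insl_multilinear y).
Qed.

Lemma bracket_wedge_alternatingl y :
  alternating (bracket_wedge (n := n) (m := m) ^~ y).
Proof.
apply: alternating_eq (bracket_wedgeEl ^~ y) _.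
exact: insertion_alternating (insl_multilinear y) (insl_alternating y).
Qed.

Lemma bracket_wedge_multilinearr x :
  multilinear (bracket_wedge (n := n) (m := m) x).
Proof.
apply: multilinear_eq (bracket_wedgeEr x) _.
exact: insertion_multilinear (insr_linear x) (insr_multilinear x).
Qed.

Lemma bracket_wedge_alternatingr x :
  alternating (bracket_wedge (n := n) (m := m) x).
Proof.
apply: alternating_eq (bracket_wedgeEr x) _.
exact: insertion_alternating (insr_multilinear x) (insr_alternating x).
Qed.

Let slice x := wedge_lift (bracket_wedge (n := n) (m := m) x).

Let slice_wedge x y : slice x (wedge y) = bracket_wedge x y.
Proof.
exact: (wedge_liftE (bracket_wedge_multilinearr x)
  (bracket_wedge_alternatingr x)).
Qed.

Let slice_linear x : linear (slice x).
Proof.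
exact: (wedge_lift_linear (bracket_wedge_multilinearr x)
  (bracket_wedge_alternatingr x)).
Qed.

Let slice0 x : slice x 0 = 0.
Proof.
by have := slice_linear x (-1) 0 0; rewrite scaler0 addr0 scaleN1r addNr.
Qed.

Let slice_multilinear Y : multilinear (slice ^~ Y).
Proof.
move=> x i a u v; elim/(@wedge_ind k g m.+1) : Y => [|b y Y IH].
  by rewrite !slice0 scaler0 addr0.
rewrite !slice_linear IH !slice_wedge bracket_wedge_multilinearl.
by rewrite !scalerDr !scalerA [b * a]mulrC addrACA.
Qed.

Let slice_alternating Y : alternating (slice ^~ Y).
Proof.
move=> x i j ij e; elim/(@wedge_ind k g m.+1) : Y => [|b y Y IH].
  exact: slice0.
rewrite slice_linear IH slice_wedge (@bracket_wedge_alternatingl y x i j) //.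
by rewrite scaler0 addr0.
Qed.

Lemma bracket_ext_wedge (x : 'rV[g]_n.+1) (y : 'rV[g]_m.+1) :
  bracket_ext (wedge x) (wedge y) = bracket_wedge x y.
Proof.
rewrite /bracket_ext.
by rewrite (wedge_liftE (@slice_multilinear _) (@slice_alternating _)) slice_wedge.
Qed.

Lemma bracket_ext_linearl Y : linear ((@bracket_ext n m)^~ Y).
Proof.
exact: (wedge_lift_linear (@slice_multilinear Y) (@slice_alternating Y)).
Qed.

Lemma bracket_ext_linearr X : linear (@bracket_ext n m X).
Proof.
move=> a Y Y'; elim/(@wedge_ind k g n.+1) : X => [|b x X IH].
  have z Z : bracket_ext 0 Z = 0 :> exterior_power g (1 + (n + m)).
    have := bracket_ext_linearl Z (-1) 0 0.
    by rewrite scaler0 addr0 scaleN1r addNr.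
  by rewrite !z scaler0 addr0.
have E Z : bracket_ext (wedge x) Z = slice x Z.
  exact: (wedge_liftE (@slice_multilinear Z) (@slice_alternating Z)).
rewrite !bracket_ext_linearl IH !E slice_linear.
by rewrite !scalerDr !scalerA [b * a]mulrC addrACA.
Qed.

End BracketWedge.

End Multivectors.

(* Main.v *)
(** Contracting [r, r]_g successively with xi, eta and zeta gives twice the
    pairing of (alpha^-1)^* zeta with
    [r# xi, r# eta] - r# (ad* (r# xi) eta - ad* (r# eta) xi), because the
    invariance of r says that r# intertwines (alpha^-1)^* and alpha.  As 2 is
    invertible, the theorem follows once functionals separate the points of g and
    of its third exterior power.  In infinite dimension the former is Zorn's
    lemma; for the latter, any X in the (n+1)-st power is fixed by a finite
    partition of unity sum_p z_p (x) zeta_p, and Euler's identity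
    sum_p z_p /\ contract zeta_p X = (n+1) X recovers X, in characteristic zero,
    from its contractions. *)
From HB Require Import structures.
From mathcomp Require Import all_boot all_order all_algebra all_fingroup.
From mathcomp Require Import ring.
From mathcomp.classical Require Import boolp classical_sets.
Require Import Defs.

Set Implicit Arguments.
Unset Strict Implicit.
Unset Printing Implicit Defensive.

Import GRing.Theory.
Local Open Scope ring_scope.

(** * Consequences of the unbundled predicate [linear] *)

Section LinearProp.
Variables (k : fieldType) (U W : lmodType k) (f : U -> W).
Hypothesis fl : linear f.

Lemma linear_prop0 : f 0 = 0.
Proof. by have := fl (-1) 0 0; rewrite scaler0 addr0 scaleN1r addNr. Qed.

Lemma linear_propD u v : f (u + v) = f u + f v.
Proof. by rewrite -[u]scale1r fl !scale1r. Qed.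

Lemma linear_propZ a u : f (a *: u) = a *: f u.
Proof. by rewrite -[_ *: u]addr0 fl linear_prop0 !addr0. Qed.

Lemma linear_propN u : f (- u) = - f u.
Proof. by rewrite -scaleN1r linear_propZ scaleN1r. Qed.

Lemma linear_propB u v : f (u - v) = f u - f v.
Proof. by rewrite linear_propD linear_propN. Qed.

Lemma linear_prop_sum (I : Type) (s : seq I) (F : I -> U) :
  f (\sum_(i <- s) F i) = \sum_(i <- s) f (F i).
Proof.
elim: s => [|i s IH]; first by rewrite !big_nil linear_prop0.
by rewrite !big_cons linear_propD IH.
Qed.
End LinearProp.

(** * Functionals on a space of arbitrary dimension *)

Section DualSeparation.
Variables (k : fieldType) (V : lmodType k).
Local Open Scope classical_set_scope.

Lemma dual_exists (f : V -> k^o) : linear f -> exists phi : dual V, phi =1 f.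
Proof.
move=> fl; pose phi : dual V := HB.pack f (GRing.isLinear.Build k V k^o *:%R f fl).
by exists phi.
Qed.

(* A subspace [M] maximal among those avoiding [u] is a hyperplane complementary
   to the line spanned by [u]. *)
Lemma dual_nonzero (u : V) : u != 0 -> exists phi : dual V, phi u = 1.
Proof.
move=> u0.
pose P (M : set V) := ~ M u /\ forall a x y, M x -> M y -> M (a *: x + y).
have [|M [[Mu ML] Mmax]] := @Zorn_bigcup V P.
  move=> F FP Ftot; split=> [[X FX Xu]|a x y [X FX Xx] [Y FY Yy]].
    by case: (FP _ FX).
  have [XY|YX] := Ftot _ _ FX FY; [exists Y => //|exists X => //].
    by apply: (FP _ FY).2 => //; apply: XY.
  by apply: (FP _ FX).2 => //; apply: YX.
(* The empty set satisfies [P], so [M 0] comes from maximality: an [M] without [0] is empty, hence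
   strictly inside [[set 0]]. *)
have M0 : M 0.
  apply: contrapT => nM0; have nM x : ~ M x.
    by move=> Mx; apply: nM0; rewrite -(addNr x) -scaleN1r; apply: ML.
  apply: (Mmax [set 0]); first by split=> [x /nM//|h]; apply/nM0/h.
  split=> [/eqP|a x y /= -> ->]; first by rewrite (negPf u0).
  by rewrite scaler0 addr0.
have MZ a x : M x -> M (a *: x) by move=> Mx; rewrite -[_ *: _]addr0; apply: ML.
have MD x y : M x -> M y -> M (x + y) by move=> ? ?; rewrite -[x]scale1r; apply: ML.
(* Otherwise [M] plus the line through [v] would be larger than [M] and still avoid [u]. *)
have ex v : exists c : k, M (v - c *: u).
  apply: contrapT => nv.
  apply: (Mmax [set x | exists c m, M m /\ x = m + c *: v]).
    split=> [x Mx|h]; first by exists 0, x; rewrite scale0r addr0.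
    apply: nv; exists 0; rewrite scale0r subr0; apply: h.
    by exists 1, 0; rewrite scale1r add0r.
  split=> [[c [m [Mm uE]]]|a _ _ [c [m [Mm ->]]] [d [n [Mn ->]]]].
    have [c0|c0] := eqVneq c 0; first by apply: Mu; rewrite uE c0 scale0r addr0.
    apply: nv; exists c^-1; rewrite uE scalerDr scalerA mulVf // scale1r.
    rewrite opprD addrC subrK -scalerN; apply: (MZ).
    by rewrite -scaleN1r; apply: (MZ).
  exists (a * c + d), (a *: m + n); split; first exact: ML.
  by rewrite scalerDr scalerA scalerDl addrACA.
pose f v : k^o := sval (cid (ex v)).
have fP v : M (v - (f v : k) *: u) := svalP (cid (ex v)).
have uniq v c d : M (v - c *: u) -> M (v - d *: u) -> c = d.
  move=> Mc Md; apply/eqP; rewrite -subr_eq0; apply/negP => /negP cd.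
  apply: Mu; have := MD _ _ (MZ (-1) _ Mc) Md.
  rewrite scaleN1r opprB addrA subrK -scalerBl => /(MZ (c - d)^-1).
  by rewrite scalerA mulVf // scale1r.
have fl : linear f.
  move=> a x y; apply: (uniq (a *: x + y)) (fP _) _.
  have -> : a *: x + y - (a *: f x + f y) *: u
      = a *: (x - f x *: u) + (y - f y *: u).
    by rewrite scalerBr scalerDl scalerA opprD addrACA.
  exact: ML.
have [phi phiE] := dual_exists fl; exists phi; rewrite phiE.
by apply: (uniq u) (fP _) _; rewrite scale1r subrr.
Qed.

Lemma dual_separates (u v : V) : (forall phi : dual V, phi u = phi v) -> u = v.
Proof.
move=> uv; apply/eqP; rewrite -subr_eq0; apply/negP => /negP /dual_nonzero[phi].
by rewrite linearB /= uv subrr => /esym/eqP; rewrite oner_eq0.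
Qed.

(* Adding [u] to a family fixed by [P = \sum_p p.2 *: p.1] uses a functional
   that is first composed with [1 - P]. *)
Lemma finite_partition_of_unity (us : seq V) :
  exists s : seq (V * dual V), forall u, u \in us ->
    \sum_(p <- s) (p.2 u : k) *: p.1 = u.
Proof.
elim: us => [|u us [s sE]]; first by exists [::].
pose P v := \sum_(p <- s) (p.2 v : k) *: p.1.
have Pl : linear P.
  move=> a x y; rewrite /P scaler_sumr -big_split; apply: eq_bigr => p _ /=.
  by rewrite linearP scalerDl scalerA.
have [Pu|] := eqVneq (u - P u) 0.
  exists s => v; rewrite inE => /predU1P[->|]; last exact: sE.
  by apply/esym/eqP; rewrite -subr_eq0 Pu.
move=> /dual_nonzero[phi phiu].
have [|psi psiE] := @dual_exists (fun v => phi (v - P v)).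
  by move=> a x y; rewrite Pl opprD addrACA -scalerBr linearP.
exists ((u - P u, psi) :: s) => v; rewrite inE big_cons /= psiE -/(P v).
case/predU1P => [->|vus]; first by rewrite phiu scale1r subrK.
by rewrite {1}/P sE // subrr linear0 scale0r add0r; apply: sE.
Qed.
End DualSeparation.

(** * Contraction of exterior powers by functionals *)

Section Contraction.
Variables (k : fieldType) (V : lmodType k).

Section Contract.
Variables (n : nat) (xi : dual V).

Definition contract_row (x : 'rV[V]_n.+1) : exterior_power V n :=
  \sum_(i < n.+1) (-1) ^+ i *: ((xi (x 0 i) : k) *: wedge (col' i x)).

Definition contract : exterior_power V n.+1 -> exterior_power V n :=
  wedge_lift contract_row.

Let G c (y : 'rV[V]_n) := (xi c : k) *: wedge y.

(** Brings the sum to the shape of the insertion lemmas, with the identity as twist. *)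
Let contract_rowE : contract_row = fun x =>
  \sum_(i < n.+1) (-1) ^+ i *: G (x 0 i) (map_mx idfun (col' i x)).
Proof. by apply: funext => x; apply: eq_bigr => i _; rewrite map_mx_id. Qed.

Let Gm c : multilinear (G c).
Proof.
by move=> x i a u v; rewrite /G wedge_multilinear scalerDr !scalerA mulrC.
Qed.

Lemma contract_row_multilinear : multilinear contract_row.
Proof.
rewrite contract_rowE; apply: insertion_multilinear => // z a u v.
by rewrite /G linearP scalerDl scalerA.
Qed.

Lemma contract_row_alternating : alternating contract_row.
Proof.
rewrite contract_rowE; apply: insertion_alternating => // c x i j ij e.
by rewrite /G (wedge_alternating ij e) scaler0.
Qed.

Lemma contract_wedge x : contract (wedge x) = contract_row x.
Proof.
exact: (wedge_liftE contract_row_multilinear contract_row_alternating).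
Qed.

Lemma contract_linear : linear contract.
Proof.
exact: (wedge_lift_linear contract_row_multilinear contract_row_alternating).
Qed.
End Contract.

Definition cons_row n (c : V) (y : 'rV[V]_n) : 'rV[V]_n.+1 :=
  row_mx (const_mx c : 'rV_1) y.

Definition wedge_cons n (c : V) : exterior_power V n -> exterior_power V n.+1 :=
  wedge_lift (fun y => wedge (cons_row c y)).

Let wedge_cons_multilinear n c :
  multilinear (fun y : 'rV[V]_n => wedge (cons_row c y)).
Proof. exact: multilinear_row_mxr (@wedge_multilinear k V (1 + n)). Qed.

Let wedge_cons_alternating n c :
  alternating (fun y : 'rV[V]_n => wedge (cons_row c y)).
Proof. exact: alternating_row_mxr (@wedge_alternating k V (1 + n)). Qed.

Lemma wedge_consE n c (y : 'rV[V]_n) :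
  wedge_cons c (wedge y) = wedge (cons_row c y).
Proof.
exact: (wedge_liftE (@wedge_cons_multilinear n c) (@wedge_cons_alternating n c)).
Qed.

Lemma wedge_cons_linear n c : linear (@wedge_cons n c).
Proof.
exact: (wedge_lift_linear (@wedge_cons_multilinear n c)
  (@wedge_cons_alternating n c)).
Qed.

Lemma cons_row_head n c (y : 'rV[V]_n) : cons_row c y 0 0 = c.
Proof.
have -> : 0 = lshift n (0 : 'I_1) :> 'I_(1 + n) by apply: val_inj.
by rewrite [LHS](row_mxEl (const_mx c : 'rV_1)) mxE.
Qed.

Lemma cons_row_tail n c (y : 'rV[V]_n) i : cons_row c y 0 (fintype.lift 0 i) = y 0 i.
Proof.
have -> : fintype.lift 0 i = rshift 1 i :> 'I_(1 + n) by apply: val_inj.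
exact: (row_mxEr (const_mx c : 'rV_1)).
Qed.

Lemma wedge_cons_row_linear n (y : 'rV[V]_n) :
  linear (fun c => wedge (cons_row c y)).
Proof.
move=> a u v; have E w : cons_row w y = upd (cons_row 0 y) 0 w.
  apply/rowP=> j; case: (unliftP 0 j) => [l|] ->.
    by rewrite upd_neq // !cons_row_tail.
  by rewrite updE cons_row_head.
by rewrite [in LHS]E (E u) (E v) wedge_multilinear.
Qed.

Lemma col'_cons_row n c (y : 'rV[V]_n) : col' 0 (cons_row c y) = y.
Proof. by apply/rowP=> i; rewrite mxE cons_row_tail. Qed.

Lemma col'_cons_row_lift n c (y : 'rV[V]_n.+1) i :
  col' (fintype.lift 0 i) (cons_row c y) = cons_row c (col' i y).
Proof.
apply/rowP=> j; rewrite mxE.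
case: (unliftP 0 j) => [l|] ->.
  have -> : fintype.lift (fintype.lift 0 i) (fintype.lift 0 l)
      = fintype.lift 0 (fintype.lift i l).
    by apply: val_inj; rewrite /= /bump !add1n ltnS addnS.
  by rewrite !cons_row_tail mxE.
have -> : fintype.lift (fintype.lift 0 i) 0 = 0 by apply: val_inj.
by rewrite !cons_row_head.
Qed.

(** Contraction is an antiderivation: index 0 gives the first term, and shifting the other indices
    by one gives the minus sign. The empty tail is left to [contract_wedge1]. *)
Lemma contract_cons n xi c (y : 'rV[V]_n.+1) :
  contract xi (wedge (cons_row c y)) =
    (xi c : k) *: wedge y - wedge_cons c (contract xi (wedge y)).
Proof.
rewrite !contract_wedge /contract_row big_ord_recl /= expr0 scale1r.
rewrite cons_row_head col'_cons_row; congr (_ + _).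
rewrite (linear_prop_sum (wedge_cons_linear c)) -sumrN; apply: eq_bigr => i _.
rewrite cons_row_tail col'_cons_row_lift !(linear_propZ (wedge_cons_linear c)).
by rewrite wedge_consE exprS mulN1r scaleNr.
Qed.

Lemma contract_wedge1 xi (x : 'rV[V]_1) : contract xi (wedge x) = (xi (x 0 0) : k) *: wedge 0.
Proof.
rewrite contract_wedge /contract_row big_ord1 expr0 scale1r.
by congr (_ *: wedge _); apply/rowP; case.
Qed.

(** Moving column [i] to the front is a cycle of sign [(-1) ^+ i]. *)
Lemma wedge_cons_col' n (x : 'rV[V]_n.+1) i :
  wedge (cons_row (x 0 i) (col' i x)) = (-1) ^+ i *: wedge x.
Proof.
have -> : cons_row (x 0 i) (col' i x) = col_perm (lift_perm 0 i 1) x.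
  apply/rowP=> j; rewrite [RHS]mxE; case: (unliftP 0 j) => [l|] ->.
    by rewrite cons_row_tail lift_perm_lift perm1 mxE.
  by rewrite cons_row_head lift_perm_id.
rewrite (alternating_perm _ _ (@wedge_multilinear k V _) (@wedge_alternating k V _)).
by rewrite odd_lift_perm odd_perm1 addbF signr_odd.
Qed.

(* Euler's identity [\sum_p p.1 /\ contract p.2 X = n.+1 X] for a partition of
   unity fixing the vectors that occur in [X]. *)
Lemma euler n (X : exterior_power V n.+1) : exists s : seq (V * dual V),
  \sum_(p <- s) wedge_cons p.1 (contract p.2 X) = n.+1%:R *: X.
Proof.
pose fixes (us : seq V) (s : seq (V * dual V)) :=
  forall u, u \in us -> \sum_(p <- s) (p.2 u : k) *: p.1 = u.
(* The vectors [us] are collected before [s] is chosen, so that one partition serves all terms of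
   [X]. *)
suff [us usE] : exists us : seq V, forall s, fixes us s ->
    \sum_(p <- s) wedge_cons p.1 (contract p.2 X) = n.+1%:R *: X.
  by have [s /usE] := finite_partition_of_unity us; exists s.
elim/(@wedge_ind k V n.+1) : X => [|a x X [us IH]].
  exists [::] => s _; rewrite scaler0 big1 // => p _.
  by rewrite (linear_prop0 (contract_linear _)) (linear_prop0 (wedge_cons_linear _)).
exists ([seq x 0 i | i <- enum 'I_n.+1] ++ us) => s sP.
rewrite scalerDr -(IH s) => [|u uus]; last by apply: sP; rewrite mem_cat uus orbT.
rewrite scalerA mulrC -scalerA.
under eq_bigr do rewrite contract_linear wedge_cons_linear.
rewrite [LHS]big_split; congr (_ + _).
rewrite -scaler_sumr; congr (_ *: _).
have -> : n.+1%:R *: wedge x = \sum_(i < n.+1) wedge x.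
  by rewrite sumr_const card_ord scaler_nat.
under eq_bigr => p _.
  rewrite contract_wedge /contract_row (linear_prop_sum (wedge_cons_linear _)).
  under eq_bigr do rewrite !(linear_propZ (wedge_cons_linear _)) wedge_consE.
  over.
rewrite exchange_big; apply: eq_bigr => i _ /=.
(* For fixed [i] the sum over [p] moves into the first slot, where it rebuilds [x 0 i]; the two
   signs [(-1) ^+ i] then cancel. *)
rewrite -scaler_sumr.
under eq_bigr do rewrite -(linear_propZ (wedge_cons_row_linear _)).
rewrite -(linear_prop_sum (wedge_cons_row_linear _)) sP.
  by rewrite wedge_cons_col' scalerA -expr2 sqrr_sign scale1r.
by rewrite mem_cat map_f ?mem_enum.
Qed.

Lemma contract_inj n (X : exterior_power V n.+1) : [pchar k] =i pred0 ->
  (forall xi, contract xi X = 0) -> X = 0.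
Proof.
move=> k0 X0; have [s] := euler X.
rewrite big1 => [/esym/eqP|p _]; last first.
  by rewrite X0 (linear_prop0 (wedge_cons_linear _)).
rewrite scaler_eq0 => /orP[|/eqP //].
by rewrite (pcharf0P k).1.
Qed.

(** On empty rows the constant 1 is vacuously multilinear and alternating, so it lifts to a
    functional with value 1 on the empty wedge. Scalars can thus be read off full contractions. *)
Lemma wedge0_neq0 : wedge (0 : 'rV[V]_0) != 0.
Proof.
apply/eqP=> w0; have m : multilinear (fun=> 1 : k^o) (n := 0) (V := V) by move=> x [].
have a : alternating (fun=> 1 : k^o) (n := 0) (V := V) by move=> x [].
have := wedge_liftE m a 0; rewrite w0 (linear_prop0 (wedge_lift_linear m a)).
by move/esym/eqP; rewrite oner_eq0.
Qed.
End Contraction.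

(** * Triple contractions and the operator of a bivector *)

Section TripleContraction.
Variables (k : fieldType) (V : lmodType k).
Implicit Types (xi eta zeta : dual V).

(* Functionals take values in [k^o]; the casts select the operations of [k],
   which [ring] and the scalings need. *)
Lemma dual_comb xi (a : k) u v : xi (a *: u + v) = a * (xi u : k) + (xi v : k) :> k.
Proof. exact: linearP. Qed.

Lemma dual0 xi : xi 0 = 0 :> k.
Proof. exact: linear0. Qed.

Lemma dualB xi u v : xi (u - v) = (xi u : k) - (xi v : k) :> k.
Proof. exact: linearB. Qed.

Lemma dualZ xi (a : k) u : xi (a *: u) = a * (xi u : k) :> k.
Proof. exact: (linearZ_LR xi). Qed.

Definition contract3 xi eta zeta (X : exterior_power V 3) : exterior_power V 0 :=
  contract zeta (contract eta (contract xi X)).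

Lemma contract3_linear xi eta zeta : linear (contract3 xi eta zeta).
Proof. by move=> a X Y; rewrite /contract3 !contract_linear. Qed.

Lemma contract2_cons xi eta a b :
  contract eta (contract xi (wedge (cons_row a (cons_row b 0)))) =
    (xi a * eta b - xi b * eta a : k) *: wedge (0 : 'rV[V]_0).
Proof.
rewrite contract_cons contract_wedge1 (linear_propZ (wedge_cons_linear _)).
rewrite wedge_consE (linear_propB (contract_linear _)).
rewrite !(linear_propZ (contract_linear _)) !contract_wedge1 !cons_row_head.
by rewrite !scalerA -scalerBl.
Qed.

(** The coefficient is the determinant of the values of [xi], [eta], [zeta] on [a], [b], [c],
    expanded along [xi]. *)
Lemma contract3_cons xi eta zeta a b c :
  contract3 xi eta zeta (wedge (cons_row a (cons_row b (cons_row c 0)))) =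
    (xi a * (eta b * zeta c - eta c * zeta b)
     - xi b * (eta a * zeta c - eta c * zeta a)
     + xi c * (eta a * zeta b - eta b * zeta a) : k) *: wedge (0 : 'rV[V]_0).
Proof.
rewrite /contract3 !contract_cons contract_wedge1.
rewrite (linear_propB (wedge_cons_linear _)) !(linear_propZ (wedge_cons_linear _)).
rewrite !wedge_consE cons_row_head.
rewrite !(linear_propB (contract_linear _), linear_propZ (contract_linear _)).
rewrite !contract2_cons !scalerA -!scalerBl.
by congr (_ *: _); ring.
Qed.

Lemma contract3_inj (X : exterior_power V 3) : [pchar k] =i pred0 ->
  (forall xi eta zeta, contract3 xi eta zeta X = 0) -> X = 0.
Proof.
move=> k0 X0; do 3 (apply: contract_inj => // ?).
exact: X0.
Qed.

(** An explicit model of $r^\sharp$, linear in the bivector, so that identities can be checked on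
    decomposable ones. *)
Definition sharp (X : exterior_power V 2) eta : V :=
  wedge_lift (fun x => (eta (x 0 1) : k) *: x 0 0 - (eta (x 0 0) : k) *: x 0 1) X.

Section Sharp.
Variable eta : dual V.

Let f u v := (eta v : k) *: u - (eta u : k) *: v.

Let f_multilinear : multilinear (fun x : 'rV[V]_2 => f (x 0 0) (x 0 1)).
Proof.
apply: multilinear2 => [v|u] a w w'; rewrite /f (linearP eta) scalerDr scalerDl.
  by rewrite scalerBr !scalerA [_ * a]mulrC opprD addrACA.
by rewrite scalerBr !scalerA [_ * a]mulrC opprD addrACA.
Qed.

Let f_alternating : alternating (fun x : 'rV[V]_2 => f (x 0 0) (x 0 1)).
Proof. by apply: alternating2 => u; rewrite /f subrr. Qed.

Lemma sharp_wedge u v :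
  sharp (wedge (row2 u v)) eta = (eta v : k) *: u - (eta u : k) *: v.
Proof. by rewrite [LHS](wedge_liftE f_multilinear f_alternating) row2_0 row2_1. Qed.

Lemma sharp_linearl : linear (sharp^~ eta).
Proof. exact: (wedge_lift_linear f_multilinear f_alternating). Qed.
End Sharp.

Lemma bivector_ind (P : exterior_power V 2 -> Prop) :
  P 0 -> (forall a u v X, P X -> P (a *: wedge (row2 u v) + X)) -> forall X, P X.
Proof.
by move=> P0 PD; apply: wedge_ind => // a x X PX; rewrite -[x]row2K; apply: PD.
Qed.

Lemma sharp_skew X xi eta : xi (sharp X eta) = - (eta (sharp X xi) : k) :> k.
Proof.
elim/bivector_ind: X => [|b u v X IH].
  by rewrite !(linear_prop0 (sharp_linearl _)) !dual0 oppr0.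
rewrite !sharp_linearl !(dual_comb xi, dual_comb eta) IH !sharp_wedge !dualB !dualZ; ring.
Qed.

(** Skewness turns the argument of [sharp X] into the evaluated functional, where linearity is
    immediate. *)
Lemma sharp_linearr X : linear (sharp X).
Proof.
move=> a xi eta; apply: dual_separates => phi.
rewrite dual_comb [LHS]sharp_skew.
rewrite (sharp_skew X phi xi) (sharp_skew X phi eta) mulrN -opprD.
by [].
Qed.

Lemma sharpE X xi eta : xi (sharp X eta) = pair2 xi eta (wedge2_tensor X).
Proof.
have pl := pair2_linear xi eta; have wl := @wedge2_tensor_linear _ V.
elim/bivector_ind: X => [|b u v X IH].
  by rewrite (linear_prop0 (sharp_linearl _)) linear0 (linear_prop0 wl) (linear_prop0 pl).
rewrite sharp_linearl linearP IH wl pl sharp_wedge wedge2_tensor_wedge.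
rewrite (linear_propB pl) !pair2_tensor dualB !dualZ.
by congr (_ *: (_ - _) + _); apply: mulrC.
Qed.
End TripleContraction.

(** * The bracket of bivectors under triple contraction *)

Section Bracket.
Variables (k : fieldType) (g : hom_lie_algebra k).
Implicit Types (xi eta zeta : dual g).

(** This is $\alpha^*$, the inverse of [coadjoint_twist] in the regular case. *)
Definition twist_dual xi : dual g := xi \o twist.

Lemma sharp_twist_ext (X : exterior_power g 2) xi :
  sharp (twist_ext X) xi = twist (sharp X (twist_dual xi)).
Proof.
have tl := @twist_ext_linear _ g 2.
elim/bivector_ind: X => [|b u v X IH].
  by rewrite (linear_prop0 tl) !(linear_prop0 (sharp_linearl _)) linear0.
rewrite tl !sharp_linearl linearP IH twist_ext_wedge.
have -> : map_mx twist (row2 u v) = row2 (twist u) (twist v).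
  by apply/rowP=> i; rewrite !mxE; case: ifP.
by rewrite !sharp_wedge (linearB twist) !(linearZ_LR twist).
Qed.

(** A signed sum over the permutations of the three functionals: one evaluates the bracket, the
    other two meet the factors twisted by $\alpha$, whence [twist_dual]. *)
Definition bracket_pairing X Y xi eta zeta : k :=
  (xi (bracket (sharp X (twist_dual eta)) (sharp Y (twist_dual zeta))) : k)
  - (xi (bracket (sharp X (twist_dual zeta)) (sharp Y (twist_dual eta))) : k)
  - (eta (bracket (sharp X (twist_dual xi)) (sharp Y (twist_dual zeta))) : k)
  + (eta (bracket (sharp X (twist_dual zeta)) (sharp Y (twist_dual xi))) : k)
  + (zeta (bracket (sharp X (twist_dual xi)) (sharp Y (twist_dual eta))) : k)
  - (zeta (bracket (sharp X (twist_dual eta)) (sharp Y (twist_dual xi))) : k).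

Lemma bracket_pairing_combl a X X' Y xi eta zeta :
  bracket_pairing (a *: X + X') Y xi eta zeta =
    a * bracket_pairing X Y xi eta zeta + bracket_pairing X' Y xi eta zeta.
Proof.
rewrite /bracket_pairing !sharp_linearl !bracket_linearl.
rewrite !(dual_comb xi, dual_comb eta, dual_comb zeta); ring.
Qed.

Lemma bracket_pairing_combr a X Y Y' xi eta zeta :
  bracket_pairing X (a *: Y + Y') xi eta zeta =
    a * bracket_pairing X Y xi eta zeta + bracket_pairing X Y' xi eta zeta.
Proof.
rewrite /bracket_pairing !sharp_linearl !bracket_linearr.
rewrite !(dual_comb xi, dual_comb eta, dual_comb zeta); ring.
Qed.

Lemma bracket_comb xi (a b c d : k) (u1 u2 v1 v2 : g) :
  xi (bracket (a *: u1 - b *: u2) (c *: v1 - d *: v2)) =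
    a * c * (xi (bracket u1 v1) : k) - a * d * (xi (bracket u1 v2) : k)
    - b * c * (xi (bracket u2 v1) : k) + b * d * (xi (bracket u2 v2) : k) :> k.
Proof.
rewrite (linear_propB (bracket_linearl _)) !(linear_propZ (bracket_linearl _)).
rewrite !(linear_propB (bracket_linearr _)) !(linear_propZ (bracket_linearr _)).
rewrite !(dualB xi, dualZ xi); ring.
Qed.

Lemma row_mx_cons_row c (y z : 'rV[g]_1) :
  row_mx (const_mx c : 'rV_1) (row_mx y z) =
    cons_row c (cons_row (y 0 0) (cons_row (z 0 0) 0)).
Proof.
have -> : cons_row (z 0 0) 0 = z by apply/rowP=> i; rewrite ord1 cons_row_head.
by rewrite /cons_row; congr (row_mx _ (row_mx _ _)); apply/rowP=> i; rewrite ord1 mxE.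
Qed.

(** Four terms with a determinant of six products each, against six brackets expanded into four:
    both sides are the same 24 products. *)
Lemma contract3_bracket_wedge xi eta zeta (u1 u2 v1 v2 : g) :
  contract3 xi eta zeta (bracket_wedge (row2 u1 u2) (row2 v1 v2)) =
    bracket_pairing (wedge (row2 u1 u2)) (wedge (row2 v1 v2)) xi eta zeta
      *: wedge 0.
Proof.
have cl := contract3_linear xi eta zeta.
rewrite /bracket_wedge !big_ord_recl !big_ord0 !addr0.
rewrite !(linear_propD cl, linear_propZ cl) !row_mx_cons_row !contract3_cons !mxE /= /bump /= !add0n !addn0.
rewrite !scalerA -!scalerDl; congr (_ *: _).
rewrite /bracket_pairing !sharp_wedge !bracket_comb.
ring.
Qed.

Lemma contract3_bracket_ext (X Y : exterior_power g 2) xi eta zeta :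
  contract3 xi eta zeta (bracket_ext X Y) =
    bracket_pairing X Y xi eta zeta *: wedge 0.
Proof.
have cl := contract3_linear xi eta zeta.
elim/bivector_ind: X => [|a u1 u2 X IHX].
  rewrite (linear_prop0 (bracket_ext_linearl _)) (linear_prop0 cl).
  (* The coefficient -1 with both bivectors 0 shows that the pairing vanishes at 0. *)
  have := bracket_pairing_combl (-1) 0 0 Y xi eta zeta.
  by rewrite scaler0 addr0 mulN1r addNr => ->; rewrite scale0r.
rewrite bracket_ext_linearl cl IHX bracket_pairing_combl [RHS]scalerDl -scalerA.
congr (a *: _ + _).
elim/bivector_ind: Y {IHX} => [|b v1 v2 Y IHY].
  rewrite (linear_prop0 (bracket_ext_linearr _)) (linear_prop0 cl).
  have := bracket_pairing_combr (-1) (wedge (row2 u1 u2)) 0 0 xi eta zeta.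
  by rewrite scaler0 addr0 mulN1r addNr => ->; rewrite scale0r.
rewrite bracket_ext_linearr cl IHY bracket_pairing_combr [RHS]scalerDl -scalerA.
by rewrite bracket_ext_wedge contract3_bracket_wedge.
Qed.
End Bracket.

(** * Invariant bivectors and the defect of the O-operator identity *)

Section Regular.
Variables (k : fieldType) (g : regular_hom_lie_algebra k).
Variables (r : exterior_power g 2) (r_fixed : twist_fixed r).
Implicit Types (xi eta zeta : dual g).

Lemma twist_dualK xi : coadjoint_twist (twist_dual xi) = xi.
Proof. by apply: dual_ext => x; rewrite /= /coadjoint_twist_fun /= twist_invK. Qed.

Lemma coadjoint_twistK xi : twist_dual (coadjoint_twist xi) = xi.
Proof. by apply: dual_ext => x; rewrite /= /coadjoint_twist_fun /= twistK. Qed.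

(** Invariance reads $\alpha\circ r^\sharp\circ\alpha^*=r^\sharp$; here $\alpha$ is cancelled on the
    left. *)
Lemma sharp_twist_dual xi : sharp r (twist_dual xi) = twist_inv (sharp r xi).
Proof. by rewrite -[r in RHS]r_fixed sharp_twist_ext twistK. Qed.

Lemma sharp_coadjoint_twist xi : sharp r (coadjoint_twist xi) = twist (sharp r xi).
Proof. by rewrite -[r in LHS]r_fixed sharp_twist_ext coadjoint_twistK. Qed.

Definition O_defect xi eta : g :=
  bracket (sharp r xi) (sharp r eta)
  - sharp r (coadjoint_act (sharp r xi) eta - coadjoint_act (sharp r eta) xi).

(** Linearity is [sharp_linearr] and compatibility with the twists is the invariance of [r], which
    leaves the bracket identity. *)
Lemma O_operatorP :
  O_operator (coadjoint g) (sharp r) <-> forall xi eta, O_defect xi eta = 0.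
Proof.
split=> [[_ _ h] xi eta|h]; first by apply/eqP; rewrite subr_eq0; apply/eqP/h.
split=> [|xi|xi eta]; [exact: sharp_linearr | exact: sharp_coadjoint_twist |].
by apply/eqP; rewrite -subr_eq0; apply/eqP/h.
Qed.

(* The O-operator identity becomes homogeneous in the twist once paired with
   [coadjoint_twist zeta] instead of [zeta]. *)
Lemma bracket_pairing_defect xi eta zeta :
  bracket_pairing r r xi eta zeta =
    2%:R * (coadjoint_twist zeta (O_defect xi eta) : k).
Proof.
(* Skewness frees the coadjoint terms from [sharp r], so that their definition turns them into
   brackets. *)
rewrite /O_defect dualB [X in _ - X]sharp_skew sharp_coadjoint_twist.
rewrite /= /coadjoint_twist_fun /coadjoint_act_fun !twistK twist_inv_bracket.
rewrite /bracket_pairing !sharp_twist_dual.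
set p := twist_inv (sharp r xi); set q := twist_inv (sharp r eta).
set s := twist_inv (sharp r zeta).
have dualN (phi : dual g) x : phi (- x) = - (phi x : k) :> k by exact: linearN.
(* With both bivectors equal to [r] the six terms agree in pairs, whence the factor 2. *)
rewrite (bracket_skew q p) (bracket_skew s p) (bracket_skew s q).
rewrite !(dualN xi, dualN eta, dualN zeta); ring.
Qed.
End Regular.

Theorem theorem5p7 (k : fieldType) (k_char0 : [pchar k] =i pred0)
    (g : regular_hom_lie_algebra k) (r : exterior_power g 2)
    (r_fixed : twist_fixed r) (rsharp : dual g -> g)
    (rsharpE : forall xi eta : dual g,
       xi (rsharp eta) = pair2 xi eta (wedge2_tensor r)) :
  r_matrix r <-> O_operator (coadjoint g) rsharp.
Proof.
have -> : rsharp = sharp r.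
  by apply: funext => eta; apply: dual_separates => xi; rewrite rsharpE sharpE.
rewrite O_operatorP //; split=> [[_ r0] xi eta|defect0].
  (* The test functional is put in the form [coadjoint_twist _] that [bracket_pairing_defect]
     evaluates. *)
  apply: dual_separates => zeta; rewrite linear0 -(twist_dualK zeta).
  have := contract3_bracket_ext r r xi eta (twist_dual zeta).
  rewrite r0 (linear_prop0 (contract3_linear _ _ _)) bracket_pairing_defect //.
  (* The empty wedge is nonzero, and 2 is nonzero in characteristic zero. *)
  move/esym/eqP; rewrite scaler_eq0 (negPf (wedge0_neq0 _)) orbF mulf_eq0.
  by rewrite (pcharf0P k).1 //= => /eqP.
split=> //; apply: contract3_inj => // xi eta zeta.
rewrite contract3_bracket_ext bracket_pairing_defect // defect0.
by rewrite dual0 mulr0 scale0r.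
Qed.
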